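(* Let $\mathcal{A}$ be a commutative C*-algebra, let $a_1, a_2 \in \mathcal{A}$, and let $P(z) = (z-a_1)(z-a_2)$ for $z \in \mathcal{A}$ (a polynomial of degree $n = 2$ over $\mathcal{A}$). If $z \in \mathcal{A}$ is not a critical point of $P$, then there exists a critical point $w \in \mathcal{A}$ of $P$ such that $$\frac{\|P(z)-P(w)\|}{\|z-w\|} \leq 1\cdot\|P'(z)\| \quad\text{or}\quad \frac{\|P(z)-P(w)\|}{\|z-w\|} \leq \frac{n-1}{n}\,\|P'(z)\| = \frac{1}{2}\,\|P'(z)\|.$$
   Context: C*-algebras are complex and not assumed unital. For $P(z) = (z-a_1)(z-a_2)$ with $a_1,a_2 \in \mathcal{A}$, the derivative is defined by $P'(z) = (z-a_2) + (z-a_1)$ for all $z \in \mathcal{A}$ (the sum over $j$ of the product with the factor $z-a_j$ omitted). An element $w \in \mathcal{A}$ is a critical point of $P$ if $P'(w) = 0$; thus $z$ is not a critical point of $P$ if $P'(z) \neq 0$, and then $z \neq w$ for every critical point $w$. *)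

(* Defs.v *)
From HB Require Import structures.
From mathcomp Require Import all_boot all_order all_algebra.
From mathcomp Require Import complex.
From mathcomp Require Import all_classical all_reals all_analysis.

Set Implicit Arguments.
Unset Strict Implicit.
Unset Printing Implicit Defensive.

Import Order.TTheory GRing.Theory Num.Theory.
Import numFieldNormedType.Exports.

Local Open Scope ring_scope.
Local Open Scope complex_scope.

(* The complex numbers are R[i] for R : realType. In a normed module over R[i]
   the norm is R[i]-valued; its values are nonnegative, hence real, and on real
   elements the (partial) order of R[i] is the usual order of R.

   The product is a new operation rather than the one of a ring structure,
   since the ring structures of the library all have a unit. *)
HB.mixin Record isCStarAlgebra (R : realType) A
    of CompleteNormedModule R[i] A := {
  cmul : A -> A -> A;
  cmulA : associative cmul;
  cmulDl : left_distributive cmul +%R;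
  cmulDr : right_distributive cmul +%R;
  cscalerAl : forall (k : R[i]) (x y : A), k *: cmul x y = cmul (k *: x) y;
  cscalerAr : forall (k : R[i]) (x y : A), k *: cmul x y = cmul x (k *: y);
  normr_cmul : forall x y : A, `|cmul x y| <= `|x| * `|y|;
  star : A -> A;
  starK : involutive star;
  starD : {morph star : x y / x + y};
  starZ : forall (k : R[i]) (x : A), star (k *: x) = Num.conj k *: star x;
  starM : forall x y : A, star (cmul x y) = cmul (star y) (star x);
  normr_star_mul : forall x : A, `|cmul (star x) x| = `|x| ^+ 2
}.

#[short(type="cstarAlgType")]
HB.structure Definition CStarAlgebra (R : realType) :=
  {A of CompleteNormedModule R[i] A & isCStarAlgebra R A}.

Section QuadraticPolynomial.
Variables (R : realType) (A : cstarAlgType R) (a1 a2 : A).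

Definition quad_poly (z : A) : A := cmul (z - a1) (z - a2).

Definition quad_deriv (z : A) : A := (z - a2) + (z - a1).

Definition critical_point (w : A) : Prop := quad_deriv w = 0.

End QuadraticPolynomial.

(* Main.v *)
(* With w the midpoint of a1 and a2 and u = z - w, commutativity gives
   P(z) - P(w) = u^2, while P'(z) = 2u: the second alternative is |u^2| <= |u|^2. *)

Require Import Defs.
From HB Require Import structures.
From mathcomp Require Import all_boot all_order all_algebra.
From mathcomp Require Import complex.
From mathcomp Require Import all_classical all_reals all_analysis.

Set Implicit Arguments.
Unset Strict Implicit.
Unset Printing Implicit Defensive.

Import Order.TTheory GRing.Theory Num.Theory.
Import numFieldNormedType.Exports.

Local Open Scope ring_scope.
Local Open Scope complex_scope.

(** Centre everything at the midpoint [w] of the roots, which is a critical point. With [h = a1 - w]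
    the roots are w + h and w - h, so for [u = z - w] one gets P(z) = u^2 - h^2, P(w) = -h^2 and
    P'(z) = 2u. Thus P(z) - P(w) = u^2, and submultiplicativity of the norm gives the bound with
    factor 1/2. *)

Lemma cmulNl (R : realType) (A : cstarAlgType R) (x y : A) :
  cmul (- x) y = - cmul x y.
Proof. by rewrite -scaleN1r -cscalerAl scaleN1r. Qed.

(** Commutativity enters the argument only here, to cancel the two cross terms. *)
Lemma cmul_subr_addr (R : realType) (A : cstarAlgType R)
    (cmulC : commutative (@cmul R A)) (x y : A) :
  cmul (x - y) (x + y) = cmul x x - cmul y y.
Proof.
by rewrite cmulDl !cmulDr !cmulNl (cmulC y x) addrA addrK.
Qed.

Theorem theorem2p4 (R : realType) (A : cstarAlgType R)
  (cmulC : commutative (@cmul R A)) (a1 a2 z : A)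
  (hz : ~ critical_point a1 a2 z) :
  exists w : A, critical_point a1 a2 w /\
    (`|quad_poly a1 a2 z - quad_poly a1 a2 w| / `|z - w|
       <= 1 * `|quad_deriv a1 a2 z|
     \/
     `|quad_poly a1 a2 z - quad_poly a1 a2 w| / `|z - w|
       <= (2 - 1) / 2 * `|quad_deriv a1 a2 z|).
Proof.
pose w : A := 2^-1 *: (a1 + a2); pose h := a1 - w; pose u := z - w.
have ww : w + w = a1 + a2.
  by rewrite -mulr2n -scaler_nat scalerA divff ?scale1r ?pnatr_eq0.
have za1 : z - a1 = u - h by rewrite /u /h opprB addrA subrK.
have za2 : z - a2 = u + h.
  by rewrite /u /h addrACA -opprD ww opprD addrA addrK.
have wa1 : w - a1 = - h by rewrite opprB.
have wa2 : w - a2 = h.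
  by apply/eqP; rewrite /h subr_eq addrAC eq_sym subr_eq ww.
have dP : quad_deriv a1 a2 z = u *+ 2.
  by rewrite /quad_deriv za1 za2 addrACA subrr addr0 mulr2n.
have PzPw : quad_poly a1 a2 z - quad_poly a1 a2 w = cmul u u.
  rewrite /quad_poly za1 za2 wa1 wa2 cmul_subr_addr // cmulNl opprK.
  exact: subrK.
(* Since P'(z) = 2u, noncriticality of [z] makes the denominator nonzero. *)
have u_gt0 : 0 < `|u|.
  rewrite normr_gt0; apply/eqP => u0.
  by apply: hz; rewrite /critical_point dP u0 mul0rn.
exists w; split.
  by rewrite /critical_point /quad_deriv wa1 wa2 subrr.
(* The sharper alternative holds: half of [|u| *+ 2] is the norm of [u], so clearing the denominator
   leaves |u^2| <= |u|^2. *)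
right; rewrite PzPw dP normrMn ler_pdivrMr // -[in X in X - 1]nat1r addrK.
rewrite -[`|u| *+ 2]mulr_natl mulrA divfK ?pnatr_eq0 // mul1r.
exact: normr_cmul.
Qed.
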